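(* Let $A=\widehat A+\widetilde A$ be a characteristic splitting of the matrix $A$ (which depends on $\varepsilon\in(0,1]$). Then $\operatorname{Re}(\mu)<0$ holds for all $k\in\mathbb{Z}\setminus\{0\}$ and all eigenvalues $\mu$ of the frequency matrix $\mathcal{A}_k$, with a restriction on the time step size that is independent of $\varepsilon$.
   Context: $A\in\mathbb{R}^{d\times d}$ is a constant matrix with $d$ distinct real eigenvalues and a full set of corresponding eigenvectors. It is a function of a parameter $\varepsilon\in(0,1]$, and some of its eigenvalues diverge towards infinity as $\varepsilon\to0$. It defines the linear hyperbolic system $u_t+Au_x=0$ on $[0,1]$ with periodic boundary conditions. Characteristic splitting: write $A=Q\Lambda Q^{-1}$ with $Q$ invertible and $\Lambda=\operatorname{diag}(\lambda_1,\dots,\lambda_d)$. Split $\Lambda=\widehat\Lambda+\widetilde\Lambda$ with $\widehat\Lambda,\widetilde\Lambda$ real diagonal matrices such that the entries of $\widehat\Lambda$ are bounded independently of $\varepsilon$. The characteristic splitting of $A$ is $\widehat A=Q\widehat\Lambda Q^{-1}$, $\widetilde A=Q\widetilde\Lambda Q^{-1}$. Frequency matrices: for $k\in\mathbb{Z}$, mesh size $\Delta x>0$, time step size $\Delta t>0$ and positive numerical viscosities $\widehat\alpha,\widetilde\alpha$, $$\mathcal{A}_k=-2\pi i k A-2\pi^2k^2\Delta t\left(\frac{(\widehat\alpha+\widetilde\alpha)\Delta x}{\Delta t}\,\mathrm{Id}-(\widehat A-\widetilde A)A\right).$$ These matrices govern the Fourier coefficients of the solution of the modified equation of the first-order implicit-explicit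 (IMEX) finite volume scheme based on the splitting, in which $\widehat A$ is treated explicitly (with viscosity $\widehat\alpha$) and $\widetilde A$ implicitly (with viscosity $\widetilde\alpha$). *)

(* Defs.v *)
From mathcomp Require Import all_boot all_order all_algebra.
From mathcomp Require Import all_classical all_reals all_analysis.
From mathcomp Require Export complex.

Set Implicit Arguments.
Unset Strict Implicit.
Unset Printing Implicit Defensive.

Import Order.TTheory GRing.Theory Num.Theory.
Import numFieldNormedType.Exports.
Local Open Scope ring_scope.
Local Open Scope classical_set_scope.

(* The columns of Q form a full set of (right) eigenvectors, col j Q belonging
   to the eigenvalue lam 0 j. *)
Definition distinct_real_eigensystem (R : realType) (d : nat) (A : 'M[R]_d) :=
  exists (Q : 'M[R]_d) (lam : 'rV[R]_d),
    [/\ Q \in unitmx, injective (lam 0)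
      & forall j, A *m col j Q = lam 0 j *: col j Q].

(* Divergence is in absolute value, since eigenvalues may tend to +oo or -oo.
   It is stated for a selection mu of eigenvalues, so that no ordering of the
   spectrum has to be fixed as eps varies. *)
Definition has_diverging_eigenvalue (R : realType) (d : nat)
    (A : R -> 'M[R]_d) :=
  exists mu : R -> R,
    (forall eps, 0 < eps <= 1 -> eigenvalue (A eps) (mu eps)) /\
    `|mu eps| @[eps --> 0^'+] --> +oo.

(* Lh (for \hat\Lambda) and Lt (for \tilde\Lambda) hold diagonals.  The bound M
   on the entries of Lh is chosen before eps. *)
Definition characteristic_splitting (R : realType) (d : nat)
    (A Ah At : R -> 'M[R]_d) :=
  exists (Q : R -> 'M[R]_d) (L Lh Lt : R -> 'rV[R]_d),
    (forall eps, 0 < eps <= 1 ->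
      [/\ Q eps \in unitmx,
          A eps = Q eps *m diag_mx (L eps) *m invmx (Q eps),
          diag_mx (L eps) = diag_mx (Lh eps) + diag_mx (Lt eps),
          Ah eps = Q eps *m diag_mx (Lh eps) *m invmx (Q eps)
        & At eps = Q eps *m diag_mx (Lt eps) *m invmx (Q eps)]) /\
    exists M : R, forall eps j, 0 < eps <= 1 -> `|Lh eps 0 j| <= M.

Definition frequency_matrix (R : realType) (d : nat) (A Ah At : 'M[R]_d)
    (alphah alphat dx dt : R) (k : int) : 'M[R[i]]_d :=
  (- (2 * real_complex R pi * 'i%C * k%:~R)) *: map_mx (real_complex R) A
  - map_mx (real_complex R)
      ((2 * pi ^+ 2 * k%:~R ^+ 2 * dt) *:
         (((alphah + alphat) * dx / dt)%:M - (Ah - At) *m A)).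

(* Main.v *)
Require Import Defs.
From mathcomp Require Import all_boot all_order all_algebra.
From mathcomp Require Import all_classical all_reals all_analysis.
From mathcomp Require Import complex.
From mathcomp Require Import ring lra.
Import Order.TTheory GRing.Theory Num.Theory.
Local Open Scope ring_scope.

(** The three matrices share the eigenbasis Q, hence so does the frequency
    matrix.  Its eigenvalue belonging to l = lh + lt has real part
    -2 pi^2 k^2 ((alphah + alphat) dx - dt (lh^2 - lt^2)): the implicit part
    lt only helps, and lh is bounded uniformly in eps. *)

Lemma mul_conj_diag_col (F : fieldType) (d : nat) (Q : 'M[F]_d) (l : 'rV_d)
    (j : 'I_d) :
  Q \in unitmx -> Q *m diag_mx l *m invmx Q *m col j Q = l 0 j *: col j Q.
Proof.
move=> Qu; rewrite !colE mulmxA mulmxKV // -mulmxA scalemxAr; congr (_ *m _).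
apply/matrixP => i i'; rewrite mul_diag_mx !mxE.
by case: eqP => [->|]; rewrite ?mulr0.
Qed.

(** [eigenvalue] speaks of row eigenvectors, whereas the basis consists of columns. Evaluating
    [v *m B *m col j Q] in both ways gives [mu] and [l j] times the same scalar, the [j]-th entry of
    [v *m Q]; since [Q] is invertible, this entry is nonzero for some [j]. *)
Lemma eigenvalue_of_eigenbasis (F : fieldType) (d : nat) (B Q : 'M[F]_d)
    (l : 'I_d -> F) (mu : F) :
  Q \in unitmx -> (forall j, B *m col j Q = l j *: col j Q) ->
  eigenvalue B mu -> exists j, mu = l j.
Proof.
move=> Qu BQ /eigenvalueP[v vB v_neq0].
have : v *m Q != 0.
  by apply: contraNneq v_neq0 => vQ; rewrite -(mulmxK Qu v) vQ mul0mx.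
case/rV0Pn => j vQj; exists j; apply: (mulIf vQj).
have := congr1 (mulmx v) (BQ j).
rewrite mulmxA vB -scalemxAl -scalemxAr colE mulmxA -colE.
by move/matrixP/(_ 0 0); rewrite !mxE.
Qed.

Lemma frequency_matrix_eigenvector (R : realType) (d : nat)
    (A Ah At Q : 'M[R]_d) (alphah alphat dx dt : R) (k : int)
    (j : 'I_d) (l lh lt : R) :
  A *m col j Q = l *: col j Q -> Ah *m col j Q = lh *: col j Q ->
  At *m col j Q = lt *: col j Q ->
  frequency_matrix A Ah At alphah alphat dx dt k
    *m col j (map_mx (real_complex R) Q) =
  (- (2 * real_complex R pi * 'i%C * k%:~R) * real_complex R l
   - real_complex R ((2 * pi ^+ 2 * k%:~R ^+ 2 * dt) *
       ((alphah + alphat) * dx / dt - (lh - lt) * l)))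
  *: col j (map_mx (real_complex R) Q).
Proof.
move=> Aq Ahq Atq; rewrite /frequency_matrix -map_col mulmxBl -scalemxAl -!map_mxM.
rewrite -scalemxAl mulmxBl mul_scalar_mx -mulmxA Aq -scalemxAr mulmxBl Ahq Atq.
rewrite -!scalerBl scalerA -scalerBl scalerA (mulrC l) !map_mxZ scalerA.
by rewrite -scalerBl.
Qed.

(** Since [l] is real, the advection term is purely imaginary, so only the diffusive term [x]
    reaches the real part. *)
Lemma Re_frequency_eigenvalue (R : realType) (k : int) (l x : R) :
  complex.Re (- (2 * real_complex R pi * 'i%C * k%:~R) * real_complex R l
              - real_complex R x) = - x.
Proof.
have -> : - (2 * real_complex R pi * 'i%C * k%:~R) * real_complex R l
          = 'i%C * real_complex R (- (2 * pi * k%:~R * l)).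
  by rewrite rmorphN !rmorphM rmorph_nat rmorph_int; ring.
by rewrite /= !mul0r mul1r oppr0 addr0 add0r.
Qed.

Theorem theorem2 (R : realType) (d : nat) (A Ah At : R -> 'M[R]_d)
    (hA : forall eps : R, 0 < eps <= 1 -> distinct_real_eigensystem (A eps))
    (hstiff : has_diverging_eigenvalue A)
    (hsplit : characteristic_splitting A Ah At)
    (dx alphah alphat : R)
    (hdx : 0 < dx) (halphah : 0 < alphah) (halphat : 0 < alphat) :
  exists dt0 : R, 0 < dt0 /\
    forall eps dt : R, 0 < eps <= 1 -> 0 < dt -> dt < dt0 ->
    forall k : int, k != 0 ->
    forall mu : R[i],
      eigenvalue
        (frequency_matrix (A eps) (Ah eps) (At eps) alphah alphat dx dt k) mu ->
      complex.Re mu < 0.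
Proof.
have [Q [L [Lh [Lt [LQ [M LhM]]]]]] := hsplit.
have M1_gt0 : 0 < M ^+ 2 + 1 by rewrite ltr_wpDl ?sqr_ge0.
have a_gt0 : 0 < (alphah + alphat) * dx by rewrite mulr_gt0 ?addr_gt0.
(* The threshold makes [dt * (M ^+ 2 + 1)] smaller than the total viscosity times [dx]. It is
   independent of [eps] because [M] is; the [+ 1] keeps the denominator positive when [M]
   vanishes. *)
exists ((alphah + alphat) * dx / (M ^+ 2 + 1)); split; first exact: divr_gt0.
move=> eps dt heps dt_gt0; rewrite ltr_pdivlMr // => dt_lt k k_neq0 mu hmu.
have [Qu AE LE AhE AtE] := LQ eps heps.
have QCu : map_mx (real_complex R) (Q eps) \in unitmx by rewrite map_unitmx.
have Aq j : A eps *m col j (Q eps) = L eps 0 j *: col j (Q eps).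
  by rewrite AE; exact: mul_conj_diag_col.
have Ahq j : Ah eps *m col j (Q eps) = Lh eps 0 j *: col j (Q eps).
  by rewrite AhE; exact: mul_conj_diag_col.
have Atq j : At eps *m col j (Q eps) = Lt eps 0 j *: col j (Q eps).
  by rewrite AtE; exact: mul_conj_diag_col.
have FQ j := frequency_matrix_eigenvector _ _ _ _ _ _ alphah alphat dx dt k
  _ _ _ _ (Aq j) (Ahq j) (Atq j).
have [j ->] := eigenvalue_of_eigenbasis _ _ _ _ _ _ QCu FQ hmu.
rewrite Re_frequency_eigenvalue oppr_lt0.
have -> : L eps 0 j = Lh eps 0 j + Lt eps 0 j.
  by have /matrixP/(_ j j) := LE; rewrite !mxE eqxx !mulr1n.
(* The factor [2 * pi ^+ 2 * k%:~R ^+ 2] is positive because [k] is nonzero; [dt] stays behind to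
   cancel the division by [dt]. *)
rewrite -subr_sqr -mulrA pmulr_rgt0; last first.
  rewrite -mulrA -exprMn mulr_gt0 // exprn_even_gt0 //=.
  by rewrite mulf_neq0 ?intr_eq0 // gt_eqF ?pi_gt0.
rewrite mulrBr mulrCA divff ?gt_eqF // mulr1.
(* The sign of [M] is not given: it follows from [M] bounding an absolute value. *)
have Lh2 : Lh eps 0 j ^+ 2 <= M ^+ 2.
  have LhMj := LhM eps j heps; rewrite -real_normK ?num_real // lerXn2r //.
  by rewrite nnegrE (le_trans _ LhMj).
have Lt2 : 0 <= Lt eps 0 j ^+ 2 by exact: sqr_ge0.
(* Dropping the square of the possibly unbounded [Lt eps 0 j] only enlarges the left-hand side,
   which leaves a bound in [M] alone. *)
rewrite subr_gt0 (le_lt_trans _ dt_lt) // ler_pM2l //.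
lra.
Qed.
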